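(* Let $\pi\colon X\to Y$ be a standard cyclic Galois covering map of degree $d$ between projective varieties over $k$, so that $\pi_*\mathcal{O}_X\cong\mathcal{O}_Y\oplus M^{-1}\oplus\cdots\oplus M^{1-d}$ for a line bundle $M$ on $Y$, with branch divisor $B\in|M^{\otimes d}|$. Let $E$ be a relatively Ulrich vector bundle on $X$ with respect to $\pi$, and assume that the divisor $B$ is reduced. Then the line bundle $M$ is generated by its global sections.
   Context: $k$ is an algebraically closed field of characteristic zero; a variety is an integral separated scheme of finite type over $k$. Relatively Ulrich: for a finite morphism $\pi\colon X\to Y$ of projective varieties, a coherent sheaf (or vector bundle) $E$ on $X$ is relatively Ulrich with respect to $\pi$ if $\pi_*E\cong\mathcal{O}_Y^{\oplus r}$ for some positive integer $r$. Standard cyclic cover: a ramified cyclic Galois cover $\pi\colon X\to Y$ of degree $d$ (i.e. $Y=X/(\mathbb{Z}/d\mathbb{Z})$ for a faithful action, $\pi$ the quotient map) with $\pi_*\mathcal{O}_X\cong\mathcal{O}_Y\oplus M^{-1}\oplus\cdots\oplus M^{1-d}$ for a line bundle $M$ on $Y$. Its branch divisor is $B=Z(s)$ for a nonzero section $s\in H^0(Y,M^{\otimes d})$, and $X$ is the closed subscheme $\{t^d=s\}$ of the total space of $M$, with $t$ the tautological section of the pullback of $M$. *)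

(* Defs.v *)
From HB Require Import structures.
From mathcomp Require Import all_boot all_order all_algebra.
From mathcomp Require mpoly.
From mathcomp Require Import all_classical topology.
Import (canonicals) mpoly.
Set Implicit Arguments.
Unset Strict Implicit.
Unset Printing Implicit Defensive.
Import GRing.Theory.
Local Open Scope classical_set_scope.
Local Open Scope ring_scope.

Identity Coercion set_pred : set >-> Funclass.

Record opens (X : topologicalType) := Opens {
  oset :> set X;
  oset_open : open oset
}.

Definition oT (X : topologicalType) : opens X := Opens openT.

Lemma sub_oT (X : topologicalType) (U : opens X) : U `<=` oT X.
Proof. by []. Qed.

Definition oI (X : topologicalType) (U V : opens X) : opens X :=
  Opens (openI (oset_open U) (oset_open V)).

Definition opre (X Y : topologicalType) (f : X -> Y) (cf : continuous f)
    (V : opens Y) : opens X :=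
  Opens ((continuousP f).1 cf V (oset_open V)).

(* Locality and gluing at once: locality is the uniqueness part, applied to the
   restrictions of a given section. *)
Definition sheaf_axiom (X : topologicalType) (F : opens X -> Type)
    (res : forall U V : opens X, V `<=` U -> F U -> F V) : Prop :=
  forall (I : Type) (U : opens X) (V : I -> opens X)
    (VU : forall i, V i `<=` U) (s : forall i, F (V i)),
    U `<=` \bigcup_i V i ->
    (forall (i j : I) (W : opens X) (Wi : W `<=` V i) (Wj : W `<=` V j),
       res _ _ Wi (s i) = res _ _ Wj (s j)) ->
  exists! a : F U, forall i, res _ _ (VU i) a = s i.

(* Spaces with a sheaf of commutative k-algebras.  The rings may be trivial:
   the sections over the empty set are. *)
Record ringed_space (k : comPzRingType) := RingedSpace {
  pts :> topologicalType;
  rsec : opens pts -> comPzRingType;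
  rres : forall U V : opens pts, V `<=` U -> {rmorphism rsec U -> rsec V};
  rres_id : forall (U : opens pts) (s : U `<=` U) (a : rsec U), rres s a = a;
  rres_comp : forall (U V W : opens pts) (VU : V `<=` U) (WV : W `<=` V)
    (WU : W `<=` U) (a : rsec U), rres WV (rres VU a) = rres WU a;
  rsheaf : sheaf_axiom (fun U V s => rres s : rsec U -> rsec V);
  kstr : forall U : opens pts, {rmorphism k -> rsec U};
  kstr_res : forall (U V : opens pts) (s : V `<=` U) (c : k),
    rres s (kstr U c) = kstr V c
}.

(* The germ of f at x is invertible in the stalk at x. *)
Definition unit_at (k : comPzRingType) (X : ringed_space k) (x : X)
    (U : opens X) (f : rsec U) : Prop :=
  exists (V : opens X) (s : V `<=` U) (g : rsec V), V x /\ rres s f * g = 1.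

Definition locally_ringed (k : comPzRingType) (X : ringed_space k) : Prop :=
  forall (x : X) (U : opens X), U x ->
    ~ unit_at x (0 : rsec U) /\
    forall f g : rsec U, unit_at x (f + g) -> unit_at x f \/ unit_at x g.

Record prime_ideal (R : comPzRingType) (P : set R) : Prop := PrimeIdeal {
  prime0 : P 0;
  primeN1 : ~ P 1;
  primeD : forall a b, P a -> P b -> P (a + b);
  primeMl : forall a b, P b -> P (a * b);
  primeM : forall a b, P (a * b) -> P a \/ P b
}.

(* The canonical morphism from U to Spec A, A := O(U), which sends x to the
   prime {f | f not invertible at x}, is an isomorphism: it is bijective, the
   D(f) form a basis of the topology of U, and A_f = O(D(f)) for every f. *)
Record affine (k : comPzRingType) (X : ringed_space k) (U : opens X) : Prop :=
  Affine {
  affine_pts : forall P : set (rsec U), prime_ideal P ->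
    exists! x : X, U x /\ P = [set f | ~ unit_at x f];
  affine_basis : forall (V : opens X) (x : X), V x -> U x ->
    exists f : rsec U,
      unit_at x f /\ forall y, U y -> unit_at y f -> V y;
  affine_loc : forall (f : rsec U) (D : opens X) (s : D `<=` U),
    (forall x, D x <-> U x /\ unit_at x f) ->
    [/\ exists g, rres s f * g = 1,
        forall a, rres s a = 0 -> exists n : nat, f ^+ n * a = 0
      & forall b, exists (n : nat) (a : rsec U), rres s (f ^+ n) * b = rres s a]
}.

Record scheme (k : comPzRingType) := Scheme {
  sspace :> ringed_space k;
  slocal : locally_ringed sspace;
  saffine : forall x : sspace, exists U : opens sspace, U x /\ affine U
}.

Record morphism (k : comPzRingType) (X Y : ringed_space k) := Morphism {
  mfun :> X -> Y;
  mcont : continuous mfun;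
  mco : forall V : opens Y, {rmorphism rsec V -> rsec (opre mcont V)};
  mco_res : forall (V W : opens Y) (s : W `<=` V)
    (s' : opre mcont W `<=` opre mcont V) (a : rsec V),
    rres s' (mco V a) = mco W (rres s a);
  mco_kstr : forall (V : opens Y) (c : k), mco V (kstr V c) = kstr _ c;
  mco_local : forall (x : X) (V : opens Y) (a : rsec V), V (mfun x) ->
    unit_at x (mco V a) -> unit_at (mfun x) a
}.

Arguments mcont {k X Y} f : rename.
Arguments mco_res {k X Y} f {V W} : rename.

Definition mpre (k : comPzRingType) (X Y : ringed_space k) (f : morphism X Y)
  (V : opens Y) : opens X := opre (mcont f) V.

(* The comorphisms of f and g over V live over preimages that are equal only
   propositionally; they are compared over any common open subset. *)
Definition mor_eq (k : comPzRingType) (X Y : ringed_space k)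
    (f g : morphism X Y) : Prop :=
  (forall x, f x = g x) /\
  forall (V : opens Y) (W : opens X) (Wf : W `<=` mpre f V)
    (Wg : W `<=` mpre g V) (a : rsec V),
    rres Wf (mco f V a) = rres Wg (mco g V a).

Section IdComp.
Variables (k : comPzRingType).

Section Id.
Variable X : ringed_space k.

Let id_cont : continuous (@id X).
Proof. by move=> x. Qed.

Let id_co_subproof (V : opens X) : opre id_cont V `<=` V.
Proof. by []. Qed.

Definition mor_id : morphism X X.
Proof.
refine (@Morphism k X X id id_cont
  (fun V => rres (id_co_subproof (V := V))) _ _ _).
- move=> V W s s' a; have t : opre id_cont W `<=` V by [].
  by rewrite (rres_comp _ _ t) (rres_comp _ _ t).
- by move=> V c; rewrite kstr_res.
- move=> x V a Vx [W [s [g [Wx e]]]]; have t : W `<=` V by [].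
  by exists W, t, g; split=> //; rewrite -e (rres_comp _ _ t).
Defined.
End Id.

Section Comp.
Variables (X Y Z : ringed_space k) (g : morphism Y Z) (f : morphism X Y).

Let comp_cont : continuous (g \o f).
Proof. by move=> x; apply: continuous_comp; apply: mcont. Qed.

Let comp_sub (V : opens Z) : opre comp_cont V `<=` mpre f (mpre g V).
Proof. by []. Qed.

Definition mor_comp : morphism X Z.
Proof.
refine (@Morphism k X Z (g \o f) comp_cont
  (fun V => (rres (comp_sub (V := V)) \o mco f (mpre g V)) \o mco g V) _ _ _).
- move=> V W s s' a /=.
  have t : opre comp_cont W `<=` mpre f (mpre g V) by [].
  have u : mpre g W `<=` mpre g V by move=> y; apply: s.
  have u' : mpre f (mpre g W) `<=` mpre f (mpre g V) by move=> y; apply: s.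
  by rewrite (rres_comp _ _ t) -(mco_res g s u) -(mco_res f u u') (rres_comp _ _ t).
- by move=> V c /=; rewrite !mco_kstr kstr_res.
- move=> x V a Vx [W [s [h [Wx e]]]].
  apply: mco_local => //; apply: mco_local => //.
  have t : W `<=` mpre f (mpre g V) by [].
  by exists W, t, h; split=> //; rewrite -e /= (rres_comp _ _ t).
Defined.
End Comp.
End IdComp.

Definition integral (k : comPzRingType) (X : scheme k) : Prop :=
  [set: X] !=set0 /\
  forall U : opens X, U !=set0 ->
    (1 : rsec U) <> 0 /\ forall a b : rsec U, a * b = 0 -> a = 0 \/ b = 0.

Definition closed_immersion (k : comPzRingType) (X Y : scheme k)
    (f : morphism X Y) : Prop :=
  [/\ injective f,
      forall U : opens X, exists V : opens Y, mpre f V = U :> set X,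
      closed (range f)
    & forall (x : X) (U : opens X) (a : rsec U), U x ->
        exists (V : opens Y) (b : rsec V) (W : opens X) (WU : W `<=` U)
          (WV : W `<=` mpre f V), W x /\ rres WU a = rres WV (mco f V b)].

(* The usual gluing of P^n from n + 1 affine spaces: the coordinates
   x i (lift i j) identify O(U i) with a polynomial ring in n variables, and
   x i j stands for the quotient T_j / T_i of homogeneous coordinates. *)
Definition projective_space (k : comNzRingType) (n : nat) (P : scheme k) :
    Prop :=
  exists (U : 'I_n.+1 -> opens P)
    (ev : forall i, {rmorphism mpoly.mpoly n k -> rsec (U i)})
    (x : forall i : 'I_n.+1, 'I_n.+1 -> rsec (U i)),
    [/\ [set: P] `<=` \bigcup_i U i,
        forall i, affine (U i),
        forall i, [/\ bijective (ev i),
          forall c : k, ev i (mpoly.mpolyC n c) = kstr (U i) c,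
          forall j : 'I_n,
            ev i (mpoly.mpolyX k (mpoly.mnm1 j)) = x i (lift i j)
          & x i i = 1],
        forall i j p, U i p -> (U j p <-> unit_at p (x i j))
      & forall i j l (s : oI (U i) (U j) `<=` U i)
          (t : oI (U i) (U j) `<=` U j),
          rres s (x i j) * rres t (x j l) = rres s (x i l)].

Definition projective (k : comNzRingType) (X : scheme k) : Prop :=
  exists (n : nat) (P : scheme k) (f : morphism X P),
    projective_space n P /\ closed_immersion f.

(* Separatedness and finite type over k follow from projectivity. *)
Definition projective_variety (k : comNzRingType) (X : scheme k) : Prop :=
  integral X /\ projective X.

Definition finite_morphism (k : comPzRingType) (X Y : scheme k)
    (f : morphism X Y) : Prop :=
  forall y : Y, exists V : opens Y,
    [/\ V y, affine V, affine (mpre f V)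
      & exists (n : nat) (b : 'I_n -> rsec (mpre f V)),
          forall a : rsec (mpre f V), exists c : 'I_n -> rsec V,
            a = \sum_i mco f V (c i) * b i].

Record omod (k : comPzRingType) (X : ringed_space k) := OMod {
  msec : forall U : opens X, lmodType (rsec U);
  mres : forall U V : opens X, V `<=` U -> msec U -> msec V;
  mres_linear : forall (U V : opens X) (s : V `<=` U) (a : rsec U)
    (u v : msec U), mres s (a *: u + v) = rres s a *: mres s u + mres s v;
  mres_id : forall (U : opens X) (s : U `<=` U) (u : msec U), mres s u = u;
  mres_comp : forall (U V W : opens X) (VU : V `<=` U) (WV : W `<=` V)
    (WU : W `<=` U) (u : msec U), mres WV (mres VU u) = mres WU u;
  msheaf : sheaf_axiom (fun U V s => @mres U V s)
}.

Record omhom (k : comPzRingType) (X : ringed_space k) (E F : omod X) :=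
  OMHom {
  mhom :> forall U : opens X, {linear msec E U -> msec F U};
  mhom_res : forall (U V : opens X) (s : V `<=` U) (u : msec E U),
    mres s (mhom U u) = mhom V (mres s u)
}.

Definition omiso (k : comPzRingType) (X : ringed_space k) (E F : omod X)
    (h : omhom E F) : Prop :=
  forall U : opens X, bijective (h U).

Definition oisomorphic (k : comPzRingType) (X : ringed_space k)
    (E F : omod X) : Prop :=
  exists h : omhom E F, omiso h.

Section StructureSheaf.
Variables (k : comPzRingType) (X : ringed_space k).

Definition ostruct : omod X.
Proof.
refine (@OMod k X (fun U => (rsec U)^o) (fun U V s => rres s) _ _ _ _).
- by move=> U V s a u v; rewrite rmorphD rmorphM.
- exact: rres_id.
- exact: rres_comp.
- exact: rsheaf.
Defined.
End StructureSheaf.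

Section DirectSum.
Variables (k : comPzRingType) (X : ringed_space k) (n : nat).
Variable F : 'I_n -> omod X.

Definition dsum_sec (U : opens X) : Type := forall i : 'I_n, msec (F i) U.

Section Sections.
Variable U : opens X.
Implicit Types (u v w : dsum_sec U) (a b : rsec U).

HB.instance Definition _ := gen_eqMixin (dsum_sec U).
HB.instance Definition _ := gen_choiceMixin (dsum_sec U).

Let dzero : dsum_sec U := fun=> 0.
Let dopp u : dsum_sec U := fun i => - u i.
Let dadd u v : dsum_sec U := fun i => u i + v i.
Let dscale a u : dsum_sec U := fun i => a *: u i.

Let daddA : associative dadd.
Proof. by move=> u v w; apply: functional_extensionality_dep => i; exact: addrA. Qed.
Let daddC : commutative dadd.
Proof. by move=> u v; apply: functional_extensionality_dep => i; exact: addrC. Qed.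
Let dadd0 : left_id dzero dadd.
Proof. by move=> u; apply: functional_extensionality_dep => i; exact: add0r. Qed.
Let daddN : left_inverse dzero dopp dadd.
Proof. by move=> u; apply: functional_extensionality_dep => i; exact: addNr. Qed.

HB.instance Definition _ :=
  GRing.isZmodule.Build (dsum_sec U) daddA daddC dadd0 daddN.

Let dscaleA a b u : dscale a (dscale b u) = dscale (a * b) u.
Proof. by apply: functional_extensionality_dep => i; exact: scalerA. Qed.
Let dscale1 : left_id 1 dscale.
Proof. by move=> u; apply: functional_extensionality_dep => i; exact: scale1r. Qed.
Let dscaleDr : right_distributive dscale +%R.
Proof. by move=> a u v; apply: functional_extensionality_dep => i; exact: scalerDr. Qed.
Let dscaleDl u : {morph dscale^~ u : a b / a + b}.
Proof. by move=> a b; apply: functional_extensionality_dep => i; exact: scalerDl. Qed.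

HB.instance Definition _ := GRing.Zmodule_isLmodule.Build
  (rsec U) (dsum_sec U) dscaleA dscale1 dscaleDr dscaleDl.

End Sections.

Definition dsum : omod X.
Proof.
refine (@OMod k X (fun U => dsum_sec U : lmodType (rsec U))
  (fun U V s u i => mres s (u i)) _ _ _ _).
- move=> U V s a u v; apply: functional_extensionality_dep => i.
  exact: mres_linear.
- move=> U s u; apply: functional_extensionality_dep => i; exact: mres_id.
- move=> U V W VU WV WU u; apply: functional_extensionality_dep => i.
  exact: mres_comp.
- move=> I U V VU s cov agree.
  have H i : exists! a : msec (F i) U, forall l, mres (VU l) a = s l i.
    apply: (@msheaf _ _ (F i) I U V VU (fun l => s l i) cov) => l l' W Wl Wl'.
    exact: (f_equal (fun f : dsum_sec W => f i) (agree l l' W Wl Wl')).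
  pose a : dsum_sec U := fun i => projT1 (cid (H i)).
  have Ha i := projT2 (cid (H i)); exists a; split=> [l|b Hb].
    apply: functional_extensionality_dep => i; exact: (Ha i).1.
  apply: functional_extensionality_dep => i; apply: (Ha i).2 => l.
  exact: (f_equal (fun f : dsum_sec (V l) => f i) (Hb l)).
Defined.

Definition dsum_in (i : 'I_n) (U : opens X) (u : msec (F i) U) :
    msec dsum U :=
  dfwith (fun j => 0 : msec (F j) U) i u.

End DirectSum.

Definition ofree (k : comPzRingType) (X : ringed_space k) (r : nat) : omod X :=
  dsum (fun _ : 'I_r => ostruct X).

Section Pushforward.
Variables (k : comPzRingType) (X Y : ringed_space k) (f : morphism X Y).
Variable E : omod X.

Definition push_sec (V : opens Y) : Type := msec E (mpre f V).

Section Sections.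
Variable V : opens Y.

HB.instance Definition _ := GRing.Zmodule.on (push_sec V).

Let pscale (a : rsec V) (u : push_sec V) : push_sec V :=
  (mco f V a : rsec (mpre f V)) *: (u : msec E (mpre f V)).
Let pscaleA a b u : pscale a (pscale b u) = pscale (a * b) u.
Proof. by rewrite /pscale scalerA rmorphM. Qed.
Let pscale1 : left_id 1 pscale.
Proof. by move=> u; rewrite /pscale rmorph1 scale1r. Qed.
Let pscaleDr : right_distributive pscale +%R.
Proof. by move=> a u v; exact: scalerDr. Qed.
Let pscaleDl u : {morph pscale^~ u : a b / a + b}.
Proof. by move=> a b; rewrite /pscale rmorphD; exact: scalerDl. Qed.

HB.instance Definition _ := GRing.Zmodule_isLmodule.Build
  (rsec V) (push_sec V) pscaleA pscale1 pscaleDr pscaleDl.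

End Sections.

Let psub (V W : opens Y) (s : W `<=` V) : mpre f W `<=` mpre f V.
Proof. by move=> x; exact: s. Qed.

Definition push : omod Y.
Proof.
refine (@OMod k Y (fun V => push_sec V : lmodType (rsec V))
  (fun V W s u => mres (psub s) u) _ _ _ _).
- move=> V W s a u v; rewrite [LHS]mres_linear.
  by rewrite (mco_res f s (psub s)).
- move=> V s u; exact: mres_id.
- move=> U V W VU WV WU u; exact: mres_comp.
- move=> I U V VU s cov agree.
  apply: (@msheaf _ _ E I (mpre f U) (fun i => mpre f (V i))
    (fun i => psub (VU i)) s).
    by move=> x /cov [i _ Vi]; exists i.
  move=> i j W Wi Wj.
  have t : mpre f (oI (V i) (V j)) `<=` mpre f (V i) by move=> x [].
  have t' : mpre f (oI (V i) (V j)) `<=` mpre f (V j) by move=> x [].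
  have w : W `<=` mpre f (oI (V i) (V j)).
    by move=> x Wx; split; [exact: Wi | exact: Wj].
  rewrite -(mres_comp t w Wi) -(mres_comp t' w Wj); congr (mres w _).
  have p : oI (V i) (V j) `<=` V i by move=> x [].
  have p' : oI (V i) (V j) `<=` V j by move=> x [].
  have := agree i j _ p p'.
  by rewrite (Prop_irrelevance (psub p) t) (Prop_irrelevance (psub p') t').
Defined.

End Pushforward.

Section MultilinearForms.
Variables (k : comPzRingType) (X : ringed_space k) (n : nat) (L : omod X).

Record mform (U : opens X) := MForm {
  mf :> forall V : opens X, V `<=` U -> ('I_n -> msec L V) -> rsec V;
  mf_linear : forall (V : opens X) (s : V `<=` U) (m : 'I_n -> msec L V)
    (i : 'I_n) (a : rsec V) (u v : msec L V),
    mf s [eta m with i |-> a *: u + v] =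
    a * mf s [eta m with i |-> u] + mf s [eta m with i |-> v];
  mf_res : forall (V W : opens X) (VU : V `<=` U) (WV : W `<=` V)
    (WU : W `<=` U) (m : 'I_n -> msec L V),
    rres WV (mf VU m) = mf WU (fun i => mres WV (m i))
}.

Lemma mform_ext (U : opens X) (p q : mform U) :
  (forall (V : opens X) (s : V `<=` U) m, p V s m = q V s m) -> p = q.
Proof.
case: p q => [p p1 p2] [q q1 q2] /= H.
have e : p = q.
  apply: functional_extensionality_dep => V.
  apply: functional_extensionality_dep => s.
  by apply: functional_extensionality_dep => m; exact: H.
by subst q; rewrite (Prop_irrelevance p1 q1) (Prop_irrelevance p2 q2).
Qed.

Section Sections.
Variable U : opens X.
Implicit Types (p q r : mform U) (a b : rsec U).

HB.instance Definition _ := gen_eqMixin (mform U).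
HB.instance Definition _ := gen_choiceMixin (mform U).

Let fzero : mform U.
Proof.
refine (@MForm U (fun V s m => 0) _ _) => *.
  by rewrite mulr0 addr0.
by rewrite rmorph0.
Defined.

Let fopp p : mform U.
Proof.
refine (@MForm U (fun V s m => - p V s m) _ _) => *.
  by rewrite mf_linear opprD mulrN.
by rewrite rmorphN /= mf_res.
Defined.

Let fadd p q : mform U.
Proof.
refine (@MForm U (fun V s m => p V s m + q V s m) _ _) => *.
  by rewrite !mf_linear mulrDr addrACA.
by rewrite rmorphD /= !mf_res.
Defined.

Let fscale a p : mform U.
Proof.
refine (@MForm U (fun V s m => rres s a * p V s m) _ _).
  by move=> *; rewrite !mf_linear mulrDr mulrCA.
by move=> V W VU WV WU m; rewrite rmorphM /= mf_res (rres_comp VU WV WU).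
Defined.

Let faddA : associative fadd.
Proof. by move=> p q r; apply: mform_ext => *; exact: addrA. Qed.
Let faddC : commutative fadd.
Proof. by move=> p q; apply: mform_ext => *; exact: addrC. Qed.
Let fadd0 : left_id fzero fadd.
Proof. by move=> p; apply: mform_ext => *; exact: add0r. Qed.
Let faddN : left_inverse fzero fopp fadd.
Proof. by move=> p; apply: mform_ext => *; exact: addNr. Qed.

HB.instance Definition _ :=
  GRing.isZmodule.Build (mform U) faddA faddC fadd0 faddN.

Let fscaleA a b p : fscale a (fscale b p) = fscale (a * b) p.
Proof. by apply: mform_ext => * /=; rewrite rmorphM mulrA. Qed.
Let fscale1 : left_id 1 fscale.
Proof. by move=> p; apply: mform_ext => * /=; rewrite rmorph1 mul1r. Qed.
Let fscaleDr : right_distributive fscale +%R.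
Proof. by move=> a p q; apply: mform_ext => * /=; exact: mulrDr. Qed.
Let fscaleDl p : {morph fscale^~ p : a b / a + b}.
Proof. by move=> a b; apply: mform_ext => * /=; rewrite rmorphD mulrDl. Qed.

HB.instance Definition _ := GRing.Zmodule_isLmodule.Build
  (rsec U) (mform U) fscaleA fscale1 fscaleDr fscaleDl.

End Sections.

Definition mform_res (U V : opens X) (s : V `<=` U) (p : mform U) : mform V.
Proof.
refine (@MForm V (fun W t m => p W (subset_trans t s) m) _ _).
  by move=> *; exact: mf_linear.
by move=> *; exact: mf_res.
Defined.

Section Gluing.
Variables (I : Type) (U : opens X) (V : I -> opens X).
Variables (VU : forall l, V l `<=` U) (s : forall l, mform (V l)).
Arguments VU l _ _ : clear implicits.
Hypothesis cov : U `<=` \bigcup_l V l.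
Hypothesis agree : forall (i j : I) (W : opens X) (Wi : W `<=` V i)
  (Wj : W `<=` V j), mform_res Wi (s i) = mform_res Wj (s j).

Let subl (W : opens X) (l : I) : oI W (V l) `<=` W.
Proof. by move=> x []. Qed.
Let subr (W : opens X) (l : I) : oI W (V l) `<=` V l.
Proof. by move=> x []. Qed.

Arguments subl W l _ _ : clear implicits.
Arguments subr W l _ _ : clear implicits.

Let agree_at (i j : I) (W : opens X) (Wi : W `<=` V i) (Wj : W `<=` V j) m :
  s i W Wi m = s j W Wj m.
Proof.
have e := f_equal (fun p : mform W => p W (@subset_refl _ W) m) (agree Wi Wj).
move: e => /=.
by rewrite (Prop_irrelevance (subset_trans _ Wi) Wi)
           (Prop_irrelevance (subset_trans _ Wj) Wj).
Qed.

Let glue_at (W : opens X) (sW : W `<=` U) (m : 'I_n -> msec L W) :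
  exists! c : rsec W, forall l,
    rres (subl W l) c = s l _ (subr W l) (fun i => mres (subl W l) (m i)).
Proof.
apply: (@rsheaf _ X I W (fun l => oI W (V l)) (subl W)) => [x Wx|i j T Ti Tj].
  by have [l _ Vx] := cov (sW _ Wx); exists l.
have TW : T `<=` W by apply: subset_trans Ti (subl W i).
have T1 : T `<=` V i by apply: subset_trans Ti (subr W i).
have T2 : T `<=` V j by apply: subset_trans Tj (subr W j).
rewrite (mf_res _ _ _ T1) (mf_res _ _ _ T2) (agree_at T1 T2); congr (s j _ _ _).
by apply: functional_extensionality_dep => l; rewrite !(mres_comp _ _ TW).
Qed.

Let gval (W : opens X) (sW : W `<=` U) (m : 'I_n -> msec L W) : rsec W :=
  projT1 (cid (glue_at sW m)).

Let gvalE (W : opens X) (sW : W `<=` U) (m : 'I_n -> msec L W) l :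
  rres (subl W l) (gval sW m) =
  s l _ (subr W l) (fun i => mres (subl W l) (m i)).
Proof. by rewrite /gval; case: cid => c /= [+ _]. Qed.

Let gval_uniq (W : opens X) (sW : W `<=` U) (m : 'I_n -> msec L W) c :
  (forall l, rres (subl W l) c =
     s l _ (subr W l) (fun i => mres (subl W l) (m i))) -> gval sW m = c.
Proof. by move=> Hc; rewrite /gval; case: cid => d /= [_]; apply. Qed.

Let mres_update (W T : opens X) (t : T `<=` W) (m : 'I_n -> msec L W) i u :
  (fun j => mres t ([eta m with i |-> u] j)) =
  [eta (fun j => mres t (m j)) with i |-> mres t u].
Proof. by apply: functional_extensionality_dep => j /=; case: eqP. Qed.

Let glued : mform U.
Proof.
refine (@MForm U gval _ _).
- move=> W sW m i a u v; apply: gval_uniq => l.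
  rewrite rmorphD rmorphM /= !gvalE !mres_update mres_linear.
  exact/esym/mf_linear.
- move=> W T WU TW TU m; apply/esym; apply: gval_uniq => l.
  have t : oI T (V l) `<=` oI W (V l) by move=> x [/TW].
  have t' : oI T (V l) `<=` W by apply: subset_trans (subl T l) TW.
  rewrite (rres_comp TW _ t') -(rres_comp (subl W l) t t') gvalE.
  rewrite (mf_res _ _ _ (subr T l)); congr (s l _ _ _).
  apply: functional_extensionality_dep => j.
  by rewrite (mres_comp _ _ t') (mres_comp TW _ t').
Defined.

Lemma mform_glue : exists! p : mform U, forall l, mform_res (VU l) p = s l.
Proof.
exists glued; split=> [l|p Hp]; apply: mform_ext => W t m /=.
  apply: gval_uniq => j.
  have t' : oI W (V j) `<=` V l by apply: subset_trans (subl W j) t.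
  by rewrite (mf_res _ _ _ t'); exact: agree_at.
apply: gval_uniq => l.
have t' : oI W (V l) `<=` U by apply: subset_trans (subl W l) t.
rewrite (mf_res _ _ _ t') -Hp /=.
by rewrite (Prop_irrelevance (subset_trans _ _) t').
Qed.

End Gluing.

Definition mforms : omod X.
Proof.
refine (@OMod k X (fun U => mform U : lmodType (rsec U)) mform_res _ _ _ _).
- move=> U V s a p q; apply: mform_ext => W t m.
  exact: (f_equal (fun c => c * _ + _) (esym (rres_comp s t _ _))).
- move=> U s p; apply: mform_ext => W t m /=.
  by rewrite (Prop_irrelevance (subset_trans t s) t).
- move=> U V W VU WV WU p; apply: mform_ext => T t m /=.
  by congr (p _ _ _); exact: Prop_irrelevance.
- by move=> I U V VU s cov agree; exact: mform_glue.
Defined.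

End MultilinearForms.

Definition dual (k : comPzRingType) (X : ringed_space k) (L : omod X) :
  omod X := mforms 1 L.

(* For L locally free of finite rank, the sheaf of n-linear forms on L is the
   dual of the n-th tensor power of L, and the n-th tensor power of L is the
   sheaf of n-linear forms on the dual of L. *)
Definition tensor_pow (k : comPzRingType) (X : ringed_space k) (n : nat)
  (L : omod X) : omod X := mforms n (dual L).

Definition inv_pow (k : comPzRingType) (X : ringed_space k) (n : nat)
  (L : omod X) : omod X := mforms n L.

(* phi (x) ... (x) phi, as the form (m_1, ..., m_n) |-> prod_i phi(m_i). *)
Definition form_pow (k : comPzRingType) (X : ringed_space k) (L : omod X)
    (U : opens X) (phi : msec (dual L) U) (n : nat) : msec (inv_pow n L) U.
Proof.
refine (@MForm k X n L U
  (fun V s m => \prod_(i < n) (phi : mform 1 L U) V s (fun=> m i)) _ _).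
- move=> V s m i a u v.
  have E w : \prod_(j < n) (phi : mform 1 L U) V s
        (fun=> [eta m with i |-> w] j) =
      (phi : mform 1 L U) V s (fun=> w) *
      \prod_(j < n | j != i) (phi : mform 1 L U) V s (fun=> m j).
    rewrite (bigD1 i) //= eqxx; congr (_ * _); apply: eq_bigr => j ji.
    by rewrite (negbTE ji).
  rewrite !E mulrA -mulrDl; congr (_ * _).
  have F w : (fun=> w) = [eta (fun=> u) with ord0 |-> w] :> ('I_1 -> _).
    by apply: functional_extensionality_dep => j /=; rewrite ord1.
  by rewrite (F (a *: u + v)) mf_linear -!F.
- move=> V W VU WV WU m; rewrite rmorph_prod; apply: eq_bigr => i _.
  exact: mf_res.
Defined.

(* The value of the degree-n form s on phi, that is phi^n(s). *)
Definition form_val (k : comPzRingType) (X : ringed_space k) (n : nat)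
    (L : omod X) (s : msec (tensor_pow n L) (oT X)) (V : opens X)
    (phi : msec (dual L) V) : rsec V :=
  (s : mform n (dual L) (oT X)) V (@sub_oT _ V) (fun=> phi).

Definition free_at (k : comPzRingType) (X : ringed_space k) (E : omod X)
    (x : X) (n : nat) : Prop :=
  exists (V : opens X) (e : 'I_n -> msec E V), V x /\
    forall (W : opens X) (s : W `<=` V) (u : msec E W),
      exists! a : {ffun 'I_n -> rsec W}, u = \sum_i a i *: mres s (e i).

Definition vector_bundle (k : comPzRingType) (X : ringed_space k)
  (E : omod X) : Prop := forall x : X, exists n : nat, free_at E x n.

Definition line_bundle (k : comPzRingType) (X : ringed_space k)
  (L : omod X) : Prop := forall x : X, free_at L x 1.

Definition globally_generated (k : comPzRingType) (X : ringed_space k)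
    (E : omod X) : Prop :=
  forall (x : X) (V : opens X) (u : msec E V), V x ->
    exists (W : opens X) (s : W `<=` V) (n : nat)
      (g : 'I_n -> msec E (oT X)) (a : 'I_n -> rsec W),
      W x /\ mres s u = \sum_i a i *: mres (@sub_oT _ W) (g i).

Definition relatively_ulrich (k : comPzRingType) (X Y : scheme k)
    (f : morphism X Y) (E : omod X) : Prop :=
  exists r : nat, (0 < r)%N /\ oisomorphic (push f E) (ofree Y r).

(* 'Z_d is the ring Z/d only when 1 < d, which standard_cyclic_cover requires. *)
Definition faithful_action (k : comPzRingType) (X : ringed_space k) (d : nat)
    (act : 'Z_d -> morphism X X) : Prop :=
  [/\ mor_eq (act 0) (mor_id X),
      forall a b, mor_eq (act (a + b)) (mor_comp (act a) (act b))
    & forall a, mor_eq (act a) (mor_id X) -> a = 0].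

(* Y is the quotient topological space, with the sheaf of invariants. *)
Definition quotient_map (k : comPzRingType) (X Y : ringed_space k) (d : nat)
    (act : 'Z_d -> morphism X X) (f : morphism X Y) : Prop :=
  [/\ forall a, mor_eq (mor_comp f (act a)) f,
      forall y : Y, exists x : X, f x = y,
      forall x x' : X, f x = f x' -> exists a, act a x = x',
      forall B : set Y, open (f @^-1` B) -> open B
    & forall V : opens Y, injective (mco f V) /\
        forall b : rsec (mpre f V),
          (forall a (t : mpre f V `<=` mpre (act a) (mpre f V)),
             rres t (mco (act a) _ b) = b) ->
          exists c : rsec V, b = mco f V c].

(* Some inertia group is nontrivial: a nonzero a in Z/d fixes a point x and
   acts trivially on its residue field. *)
Definition ramified (k : comPzRingType) (X : ringed_space k) (d : nat)
    (act : 'Z_d -> morphism X X) : Prop :=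
  exists (a : 'Z_d) (x : X), [/\ a != 0, act a x = x
    & forall (U W : opens X) (t : W `<=` U) (t' : W `<=` mpre (act a) U)
        (b : rsec U), W x ->
        ~ unit_at x (rres t' (mco (act a) U b) - rres t b)].

(* theta : M^-1 -> f_* O_X is the tautological section t of f^* M, i.e. the
   morphism of Y-schemes from X to the total space Spec (Sym M^-1) of M.  As f
   is affine, the two clauses on theta say that it identifies X with the closed
   subscheme {t^d = s}: the induced map from the sum of the M^-i, i < d, to
   f_* O_X is an isomorphism, and t^d = s. *)
Definition cyclic_equation (k : comPzRingType) (X Y : scheme k)
    (f : morphism X Y) (d : nat) (M : omod Y)
    (s : msec (tensor_pow d M) (oT Y)) : Prop :=
  exists (theta : omhom (dual M) (push f (ostruct X)))
    (psi : omhom (dsum (fun i : 'I_d => inv_pow i M)) (push f (ostruct X))),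
    [/\ omiso psi,
        forall (V : opens Y) (phi : msec (dual M) V) (i : 'I_d),
          psi V (dsum_in (F := fun i : 'I_d => inv_pow i M) (form_pow phi i)) =
          (theta V phi : rsec (mpre f V)) ^+ i
      & forall (V : opens Y) (phi : msec (dual M) V),
          (theta V phi : rsec (mpre f V)) ^+ d = mco f V (form_val s phi)].

Definition standard_cyclic_cover (k : comPzRingType) (X Y : scheme k)
    (f : morphism X Y) (d : nat) (M : omod Y)
    (s : msec (tensor_pow d M) (oT Y)) : Prop :=
  [/\ (1 < d)%N,
      finite_morphism f,
      exists act : 'Z_d -> morphism X X,
        [/\ faithful_action act, quotient_map act f & ramified act],
      line_bundle M
    & s <> 0 /\ cyclic_equation f s].

(* The ideal of the zero scheme of s: M being a line bundle, it is generated
   locally by the single functions phi^n(s). *)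
Definition zero_ideal (k : comPzRingType) (Y : ringed_space k) (n : nat)
    (M : omod Y) (s : msec (tensor_pow n M) (oT Y)) (V : opens Y)
    (a : rsec V) : Prop :=
  forall y : Y, V y ->
    exists (W : opens Y) (t : W `<=` V) (phi : msec (dual M) W) (b : rsec W),
      W y /\ rres t a = b * form_val s phi.

Definition reduced_zeros (k : comPzRingType) (Y : ringed_space k) (n : nat)
    (M : omod Y) (s : msec (tensor_pow n M) (oT Y)) : Prop :=
  forall (V : opens Y) (a : rsec V) (e : nat),
    zero_ideal s (a ^+ e) -> zero_ideal s a.

(* Main.v *)
(* Multiplication by the tautological section t on pi_* E = O_Y^r is an r x r
   matrix of global sections of M; some entry generates M at each point y.
   Otherwise the matrix vanishes at y, so t^d = s excludes s(y) <> 0, and if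
   s(y) = 0 then the fibre of y is a single point, so that E has a basis on the
   preimage of a neighbourhood of y.  Its matrix entries then give
   t \in m_y (pi_* O_X)_y, contradicting the freeness of 1, t, ..., t^(d-1). *)
Require Import Defs.
From HB Require Import structures.
From mathcomp Require Import all_boot all_order all_algebra.
From mathcomp Require Import all_classical topology.
Set Implicit Arguments.
Unset Strict Implicit.
Unset Printing Implicit Defensive.
Import GRing.Theory.
Local Open Scope classical_set_scope.
Local Open Scope ring_scope.

Lemma oI_subl (X : topologicalType) (U V : opens X) : oI U V `<=` U.
Proof. by move=> x []. Qed.

Lemma oI_subr (X : topologicalType) (U V : opens X) : oI U V `<=` V.
Proof. by move=> x []. Qed.

Lemma mpre_sub (k : comPzRingType) (X Y : ringed_space k) (f : morphism X Y)
    (V W : opens Y) : W `<=` V -> mpre f W `<=` mpre f V.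
Proof. by move=> s x; exact: s. Qed.

(** * Invertibility of germs at a point *)

Section UnitAt.
Variables (k : comPzRingType) (X : ringed_space k) (x : X).

Lemma unit_at_res (U V : opens X) (s : V `<=` U) (f : rsec U) :
  V x -> unit_at x (rres s f) <-> unit_at x f.
Proof.
move=> Vx; split=> [[W [t [g [Wx e]]]]|[W [t [g [Wx e]]]]].
  exists W, (subset_trans t s), g; split=> //.
  by rewrite -e (rres_comp s t (subset_trans t s)).
pose t' := @oI_subl _ W V; pose r := @oI_subr _ W V.
exists (oI W V), r, (rres t' g); split=> //.
rewrite (rres_comp s r (subset_trans r s)).
by rewrite -(rres_comp t t' (subset_trans r s)) -rmorphM e rmorph1.
Qed.

Lemma unit_at1 (U : opens X) : U x -> unit_at x (1 : rsec U).
Proof. by move=> Ux; exists U, (@subset_refl _ U), 1; rewrite rmorph1 mulr1. Qed.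

Lemma unit_atM (U : opens X) (f g : rsec U) :
  unit_at x (f * g) <-> unit_at x f /\ unit_at x g.
Proof.
split=> [[W [t [h [Wx e]]]]|].
  split; first by exists W, t, (rres t g * h); rewrite mulrA -rmorphM.
  by exists W, t, (rres t f * h); rewrite mulrCA mulrA -rmorphM.
move=> [[V [s [a [Vx ea]]]] [W [t [b [Wx eb]]]]].
pose l := @oI_subl _ V W; pose r := @oI_subr _ V W.
exists (oI V W), (subset_trans l s), (rres l a * rres r b); split=> //.
rewrite rmorphM mulrACA -(rres_comp s l) -(rmorphM (rres l)) ea rmorph1 mul1r.
rewrite (Prop_irrelevance (subset_trans l s) (subset_trans r t)).
by rewrite -(rres_comp t r) -(rmorphM (rres r)) eb rmorph1.
Qed.

Lemma unit_atX (U : opens X) (f : rsec U) n :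
  (0 < n)%N -> unit_at x (f ^+ n) <-> unit_at x f.
Proof.
case: n => // n _; split; first by rewrite exprS => /unit_atM [].
move=> uf; elim: n => [|n IH]; first by rewrite expr1.
by rewrite exprS; apply/unit_atM.
Qed.

Hypothesis lX : locally_ringed X.

Lemma nonunit_at0 (U : opens X) : U x -> ~ unit_at x (0 : rsec U).
Proof. by move=> Ux; exact: (lX Ux).1. Qed.

Lemma nonunit_at_sum (U : opens X) (I : finType) (P : pred I) (f : I -> rsec U) :
  U x -> (forall i, P i -> ~ unit_at x (f i)) ->
  ~ unit_at x (\sum_(i | P i) f i).
Proof.
move=> Ux nf; elim/big_ind: _ => [|a b na nb|//]; first exact: nonunit_at0.
by move/(lX Ux).2 => [].
Qed.

(** This is the preimage in O(U) of the maximal ideal of the stalk. Through [affine_pts] it lets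
    points of an affine open be told apart by the functions that are not invertible there. *)
Lemma nonunit_at_prime (U : opens X) :
  U x -> prime_ideal [set f : rsec U | ~ unit_at x f].
Proof.
move=> Ux; split=> /=.
- exact: nonunit_at0.
- by apply; exact: unit_at1.
- by move=> a b na nb /(lX Ux).2 [].
- by move=> a b nb /unit_atM [].
- move=> a b nab; apply/not_andP => -[ua ub].
  by apply: nab; apply/unit_atM.
Qed.

End UnitAt.

Lemma unit_at_mco (k : comPzRingType) (X Y : ringed_space k) (f : morphism X Y)
    (x : X) (V : opens Y) (a : rsec V) :
  V (f x) -> unit_at x (mco f V a) <-> unit_at (f x) a.
Proof.
move=> Vx; split; first exact: mco_local.
move=> [W [t [g [Wx e]]]].
exists (mpre f W), (mpre_sub t), (mco f W g); split=> //.
by rewrite mco_res -rmorphM e rmorph1.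
Qed.

(** * Frames of line bundles and multilinear forms *)

Section Forms.
Variables (k : comPzRingType) (X : ringed_space k) (L : omod X).

Lemma mres0 (U V : opens X) (s : V `<=` U) : mres s (0 : msec L U) = 0.
Proof.
have := mres_linear s 1 (0 : msec L U) 0; rewrite rmorph1 !scale1r addr0.
by move/(congr1 (fun z => z - mres s 0)); rewrite subrr addrK.
Qed.

Lemma mresZ (U V : opens X) (s : V `<=` U) (a : rsec U) (u : msec L U) :
  mres s (a *: u) = rres s a *: mres s u.
Proof. by rewrite -[a *: u]addr0 mres_linear mres0 addr0. Qed.

Lemma mform_scale (n : nat) (U V : opens X) (s : V `<=` U) (p : mform n L U)
    (a : 'I_n -> rsec V) (m : 'I_n -> msec L V) :
  p V s (fun i => a i *: m i) = (\prod_i a i) * p V s m.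
Proof.
have p0 (q : 'I_n -> msec L V) i : p V s [eta q with i |-> 0] = 0.
  have := mf_linear p s q i 1 0 0; rewrite scaler0 add0r mul1r.
  by move/(congr1 (fun c => c - p V s [eta q with i |-> 0])); rewrite subrr addrK.
have pZ (q : 'I_n -> msec L V) i b u :
    p V s [eta q with i |-> b *: u] = b * p V s [eta q with i |-> u].
  by have := mf_linear p s q i b u 0; rewrite addr0 p0 addr0.
(* Induction on the list [r] of slots already scaled, since [mf_linear] frees one slot at a time;
   [uniq] prevents scaling a slot twice. *)
suff H r : uniq r -> p V s (fun i => if i \in r then a i *: m i else m i) =
    (\prod_(i <- r) a i) * p V s m.
  have := H (index_enum 'I_n) (index_enum_uniq _).
  move=> <-; congr (p V s _); apply: functional_extensionality_dep => i.
  by rewrite mem_index_enum.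
elim: r => [_|j r IH /= /andP[jr ur]]; first by rewrite big_nil mul1r.
pose q i := if i \in r then a i *: m i else m i.
have -> : (fun i => if i \in j :: r then a i *: m i else m i) =
    [eta q with j |-> a j *: m j].
  apply: functional_extensionality_dep => i; rewrite inE /q /=.
  by case: eqP => [->|].
rewrite pZ big_cons -mulrA -IH //; congr (_ * p V s _).
apply: functional_extensionality_dep => i; rewrite /q /=.
by case: eqP => [->|//]; rewrite (negbTE jr).
Qed.

(** A basis of a rank-one module and its dual basis: the first clause makes [e] a generator, the
    second makes the coefficient [phi] unique. *)
Definition dual_frame (V : opens X) (e : msec L V) (phi : mform 1 L V) : Prop :=
  forall (W : opens X) (s : W `<=` V),
    (forall u : msec L W, u = phi W s (fun=> u) *: mres s e) /\
    phi W s (fun=> mres s e) = 1.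

Lemma line_bundle_dual_frame (x : X) : line_bundle L ->
  exists (V : opens X) (e : msec L V) (phi : mform 1 L V),
    V x /\ dual_frame e phi.
Proof.
move=> /(_ x) [V [e' [Vx He]]]; pose e := e' ord0.
have H (W : opens X) (s : W `<=` V) (u : msec L W) : exists! a, u = a *: mres s e.
  have [a [ea ua]] := He W s u; exists (a ord0); split.
    by rewrite ea big_ord1.
  move=> b eb; rewrite (ua [ffun=> b]) ?ffunE // big_ord1 ffunE //.
(* The unique coefficient along [e]. Its uniqueness gives both linearity and compatibility with
   restriction, so it is a form. *)
pose c (W : opens X) (s : W `<=` V) u : rsec W := projT1 (cid (H W s u)).
have cE (W : opens X) (s : W `<=` V) u : u = c W s u *: mres s e.
  by rewrite /c; case: cid => a /= [].
have cU (W : opens X) (s : W `<=` V) u a : u = a *: mres s e -> c W s u = a.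
  by rewrite /c; case: cid => b /= [_ ub] /ub.
have phiP : exists phi : mform 1 L V, forall W s u, phi W s u = c W s (u ord0).
  unshelve eexists.
    refine (@MForm _ _ _ _ _ (fun W s u => c W s (u ord0)) _ _).
    - move=> W s m i a u v; rewrite ord1 /=; apply: cU.
      by rewrite scalerDl -scalerA -!cE.
    - move=> W T s t s' m; apply/esym/cU.
      by rewrite {1}(cE _ s (m ord0)) mresZ (mres_comp s t s').
  by [].
have [phi phiE] := phiP; exists V, e, phi; split=> // W s.
by split=> [u|]; rewrite phiE //; apply: cU; rewrite scale1r.
Qed.

Lemma dual_frame_res (V W : opens X) (s : W `<=` V) (e : msec L V)
    (phi : mform 1 L V) :
  dual_frame e phi -> dual_frame (mres s e) (mform_res s phi).
Proof.
move=> He T t; have [H1 H2] := He T (subset_trans t s).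
by split=> [u|] /=; rewrite (mres_comp s t (subset_trans t s)).
Qed.

(** Every argument is a multiple of [e], so by multilinearity a form is determined by its value on
    (e, ..., e). *)
Lemma dual_frame_span (V : opens X) (e : msec L V) (phi : mform 1 L V) (n : nat)
    (p : mform n L V) :
  dual_frame e phi ->
  p = p V (@subset_refl _ V) (fun=> e) *: form_pow (phi : msec (dual L) V) n
    :> mform n L V.
Proof.
move=> He; apply: mform_ext => W s m /=.
have [He1 He2] := He W s; rewrite (mf_res p _ s s).
have mE : m = fun i => phi W s (fun=> m i) *: mres s e.
  by apply: functional_extensionality_dep => i; exact: He1.
by rewrite {1}mE mform_scale mulrC.
Qed.

Lemma form_pow_frame (V : opens X) (e : msec L V) (phi : mform 1 L V) (n : nat) :
  dual_frame e phi ->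
  (form_pow (phi : msec (dual L) V) n : mform n L V) V (@subset_refl _ V)
    (fun=> e) = 1.
Proof.
move=> He; rewrite /form_pow /= big1 // => i _.
by have [_] := He V (@subset_refl _ V); rewrite mres_id.
Qed.

(* A line bundle is reflexive: the family A is a section of its double dual. *)
Lemma line_bundle_reflexive (A : forall V : opens X, msec (dual L) V -> rsec V) :
  line_bundle L ->
  (forall V (a : rsec V) phi, A V (a *: phi) = a * A V phi) ->
  (forall (V W : opens X) (s : W `<=` V) phi,
     rres s (A V phi) = A W (mres s phi)) ->
  exists g : msec L (oT X), forall V (e : msec L V) (phi : mform 1 L V),
    dual_frame e phi -> mres (@sub_oT _ V) g = A V phi *: e.
Proof.
move=> lL AZ Ares.
pose I := {i : {V : opens X & (msec L V * mform 1 L V)%type} |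
  dual_frame (projT2 i).1 (projT2 i).2}.
pose V (i : I) : opens X := projT1 (proj1_sig i).
pose e (i : I) : msec L (V i) := (projT2 (proj1_sig i)).1.
pose phi (i : I) : msec (dual L) (V i) := (projT2 (proj1_sig i)).2.
have He (i : I) : dual_frame (e i) (phi i) by rewrite /e /phi; case: i.
have [g [Hg _]] : exists! g : msec L (oT X),
    forall i, mres (@sub_oT _ (V i)) g = A (V i) (phi i) *: e i.
  apply: (@msheaf _ _ L I (oT X) V) => [x _|i j W Wi Wj].
    have [U [u [psi [Ux Hu]]]] := line_bundle_dual_frame x lL.
    by exists (exist _ (existT _ U (u, psi)) Hu).
  rewrite !mresZ !Ares.
  set ei := mres Wi (e i); set ej := mres Wj (e j).
  (* Transition function of the two frames: ej = c ei, while phi_i = c phi_j. The two occurrences of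
     [c] cancel out of A(phi) e, so the local sections glue. *)
  pose c := phi i W Wi (fun=> ej).
  have -> : mres Wi (phi i) = c *: mres Wj (phi j).
    apply: mform_ext => T t m /=.
    have mE : m = fun=> phi j T (subset_trans t Wj) (fun=> m ord0) *:
        mres (subset_trans t Wj) (e j).
      apply: functional_extensionality_dep => l; rewrite ord1.
      by have [+ _] := He j T (subset_trans t Wj); apply.
    rewrite {1}mE (@mform_scale 1) big_ord1 mulrC.
    rewrite /c (mf_res (phi i) Wi t (subset_trans t Wi)).
    rewrite /ej (mres_comp Wj t (subset_trans t Wj)).
    congr (_ * phi j T _ _); apply: functional_extensionality_dep => l.
    by rewrite (ord1 l).
  rewrite AZ mulrC -scalerA; congr (_ *: _).
  by have [] := He i W Wi => /(_ ej) <-.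
exists g => U u psi Hu; exact: (Hg (exist _ (existT _ U (u, psi)) Hu)).
Qed.

End Forms.

(** * Components in finite direct sums *)

Section Dsum.
Variables (k : comPzRingType) (X : ringed_space k) (n : nat) (F : 'I_n -> omod X).
Variable U : opens X.

Lemma dsum_sumE (I : finType) (u : I -> msec (dsum F) U) (i : 'I_n) :
  (\sum_l u l) i = \sum_l (u l) i.
Proof. by elim/big_rec2: _ => [//|l v w _ <-]. Qed.

Lemma dsum_inE (i : 'I_n) (u : msec (F i) U) : dsum_in u i = u.
Proof. by rewrite /dsum_in dfwithin. Qed.

Lemma dsum_in_sum (u : msec (dsum F) U) : u = \sum_i dsum_in (u i).
Proof.
apply: functional_extensionality_dep => j; rewrite dsum_sumE (bigD1 j) //=.
rewrite dsum_inE big1 ?addr0 // => i ij.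
by rewrite /dsum_in dfwithout.
Qed.

Lemma dsum_inZ (i : 'I_n) (a : rsec U) (u : msec (F i) U) :
  dsum_in (a *: u) = a *: dsum_in u.
Proof.
apply: functional_extensionality_dep => j.
case: (eqVneq i j) => [<-|ij]; first by rewrite dsum_inE /= -[u in LHS]dsum_inE.
rewrite [RHS](_ : _ = a *: dsum_in u j) // /dsum_in !dfwithout //.
by rewrite scaler0.
Qed.

End Dsum.

(** * The action of functions upstairs on a pushforward *)

Section Pushforward.
Variables (k : comPzRingType) (X Y : ringed_space k) (f : morphism X Y).

(** The type of sections of [push f E] carries only the O_Y-action; this recovers the action of f_*
    O_X. *)
Definition push_mul (E : omod X) (V : opens Y) (b : rsec (mpre f V))
    (u : msec (push f E) V) : msec (push f E) V :=
  b *: (u : msec E (mpre f V)).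

Lemma push_mulZ (E : omod X) (V : opens Y) (b : rsec (mpre f V)) (a : rsec V)
    (u : msec (push f E) V) :
  push_mul b (a *: u) = a *: push_mul b u.
Proof.
have H := @scalerA _ (msec E (mpre f V)).
by apply: (etrans (H b (mco f V a) u)); rewrite mulrC; exact/esym/H.
Qed.

Lemma push_mul_sum (E : omod X) (V : opens Y) (b : rsec (mpre f V))
    (I : finType) (u : I -> msec (push f E) V) :
  push_mul b (\sum_l u l) = \sum_l push_mul b (u l).
Proof. exact: (@scaler_sumr _ (msec E (mpre f V))). Qed.

Lemma push_resE (E : omod X) (V W : opens Y) (s : W `<=` V)
    (s' : mpre f W `<=` mpre f V) (u : msec (push f E) V) :
  mres s u = mres s' (u : msec E (mpre f V)).
Proof.
exact: (congr1 (fun t : mpre f W `<=` mpre f V => mres t (u : msec E _))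
  (Prop_irrelevance _ _)).
Qed.

Lemma push_mul_res (E : omod X) (V W : opens Y) (s : W `<=` V)
    (s' : mpre f W `<=` mpre f V) (b : rsec (mpre f V)) (u : msec (push f E) V) :
  mres s (push_mul b u) = push_mul (rres s' b) (mres s u).
Proof.
apply: (etrans (push_resE s s' (push_mul b u))).
apply: (etrans (mresZ s' b (u : msec E (mpre f V)))).
exact: (congr1 (push_mul (rres s' b)) (esym (push_resE s s' u))).
Qed.

End Pushforward.

(** * Global bases of a trivial pushforward *)

Section FreePush.
Variables (k : comPzRingType) (X Y : ringed_space k) (f : morphism X Y).
Variables (E : omod X) (r : nat) (h : omhom (push f E) (ofree Y r)).
Hypothesis hiso : omiso h.

(** The standard basis is pulled back through [h] over all of Y; as [h] commutes with restriction,
    it stays a basis over every open. *)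
Lemma free_push_basis : exists e : 'I_r -> msec (push f E) (oT Y),
  forall V : opens Y,
    (forall l i, h V (mres (@sub_oT _ V) (e l)) i = (l == i)%:R) /\
    (forall u : msec (push f E) V, u = \sum_l h V u l *: mres (@sub_oT _ V) (e l)).
Proof.
have [g gK hK] := hiso (oT Y).
pose e (l : 'I_r) := g (fun i => (l == i)%:R).
have he (V : opens Y) l i : h V (mres (@sub_oT _ V) (e l)) i = (l == i)%:R.
  by rewrite -mhom_res hK /= rmorph_nat.
exists e => V; split=> // u; apply: (bij_inj (hiso V)).
rewrite linear_sum; apply: functional_extensionality_dep => i.
have hZ l : h V (h V u l *: mres (@sub_oT _ V) (e l)) i = h V u l * (l == i)%:R.
  by rewrite linearZ -he.
rewrite dsum_sumE (bigD1 i) //= hZ eqxx mulr1 big1 ?addr0 // => j ji.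
by rewrite hZ (negbTE ji) mulr0.
Qed.

End FreePush.

(** * Fibres of the quotient map *)

Section Fibre.
Variables (k : comPzRingType) (X Y : ringed_space k) (f : morphism X Y) (d : nat).
Variable act : 'Z_d -> morphism X X.
Hypothesis qf : quotient_map act f.

(* A fibre is an orbit, so the points whose whole fibre lies in W are the image
   of the intersection of the translates of W. *)
Lemma quotient_map_tube (W : opens X) (y : Y) :
  (forall x, f x = y -> W x) -> exists V : opens Y, V y /\ mpre f V `<=` W.
Proof.
move=> yW; case: qf => finv _ orb fop _.
pose B : set Y := [set z | forall x, f x = z -> W x].
suff Bo : open B.
  by exists (Opens Bo); split=> [x /yW|x /= Bx] //; exact: Bx.
apply: fop.
have -> : f @^-1` B = ~` \bigcup_(a in setT) ~` (act a @^-1` W).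
  apply/seteqP; split=> x /= Bx.
    move=> [a _]; apply; apply: Bx; exact: (finv a).1.
  move=> x' /esym xx'; have [a <-] := orb _ _ xx'.
  by apply: contrapT => nW; apply: Bx; exists a.
apply: closed_openC; apply: closed_bigcup => [|a _]; first exact: finite_finset.
apply: open_closedC; apply: (continuousP _).1; [exact: mcont | exact: oset_open].
Qed.

End Fibre.

(** * Local algebra of the cyclic cover *)

Section CyclicCover.
Variables (k : comPzRingType) (X Y : scheme k) (f : morphism X Y) (d : nat).
Variables (M : omod Y) (s : msec (tensor_pow d M) (oT Y)).
Variable theta : omhom (dual M) (push f (ostruct X)).
Variable psi : omhom (dsum (fun i : 'I_d => inv_pow i M)) (push f (ostruct X)).
Hypothesis psi_iso : omiso psi.
Hypothesis psi_pow : forall (V : opens Y) (phi : msec (dual M) V) (i : 'I_d),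
  psi V (dsum_in (F := fun i : 'I_d => inv_pow i M) (form_pow phi i)) =
  (theta V phi : rsec (mpre f V)) ^+ i.
Hypothesis theta_pow : forall (V : opens Y) (phi : msec (dual M) V),
  (theta V phi : rsec (mpre f V)) ^+ d = mco f V (form_val s phi).
Hypothesis d_gt1 : (1 < d)%N.

Variables (V : opens Y) (e : msec M V) (phi : mform 1 M V).
Hypothesis e_phi : dual_frame e phi.
Variable y : Y.
Hypothesis Vy : V y.

Notation t := (theta V (phi : msec (dual M) V) : rsec (mpre f V)).

(** On a framed open, M^-i is spanned by phi^i, which [psi] sends to t^i. *)
Lemma cover_sections (b : rsec (mpre f V)) :
  exists a : 'I_d -> rsec V, b = \sum_i mco f V (a i) * t ^+ i.
Proof.
have [g _ gK] := psi_iso V; pose w := g b.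
exists (fun i : 'I_d => (w i : mform i M V) V (@subset_refl _ V) (fun=> e)).
rewrite -[LHS]gK -/w {1}[w]dsum_in_sum linear_sum; apply: eq_bigr => i _.
rewrite {1}[w i](dual_frame_span _ e_phi) dsum_inZ linearZ.
by rewrite psi_pow.
Qed.

(** Over a zero y of s, t^d = s makes t vanish at every point of the fibre. Hence [b] has there the
    value of its constant coefficient, which comes from Y and is the same for all points of the
    fibre. *)
Lemma cover_unit_at (b : rsec (mpre f V)) :
  ~ unit_at y (form_val s (phi : msec (dual M) V)) ->
  exists a : rsec V, forall x, f x = y -> (unit_at x b <-> unit_at y a).
Proof.
move=> ns; have [a ->] := cover_sections b.
have d0 : (0 < d)%N by apply: ltnW.
pose i0 := Ordinal d0; exists (a i0) => x fx.
have Vx : V (f x) by rewrite fx.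
have nt (i : 'I_d) (c : rsec (mpre f V)) : i != i0 -> ~ unit_at x (c * t ^+ i).
  move=> ii0 /unit_atM [_]; rewrite unit_atX; last first.
    by rewrite lt0n; apply: contra ii0 => /eqP i_0; apply/eqP/val_inj.
  move/(unit_atX _ _ d0); rewrite theta_pow unit_at_mco // fx.
  exact: ns.
rewrite (bigD1 i0) //= expr0 mulr1 -fx -(unit_at_mco (a i0) Vx).
(* The multiplier [c] serves for both 1 and -1, as the sum of higher terms is added in one direction
   and subtracted in the other. *)
have nr (c : rsec (mpre f V)) :
    ~ unit_at x (c * \sum_(i | i != i0) mco f V (a i) * t ^+ i).
  rewrite big_distrr /=; apply: nonunit_at_sum => //; first exact: slocal.
  by move=> i /nt; rewrite mulrA; apply.
have lx := (@slocal _ X x (mpre f V) Vx).2.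
split=> [/lx [//|]|]; first by rewrite -[X in unit_at x X]mul1r => /nr.
set r := \sum_(i | _) _; rewrite -{1}[mco f V (a i0)](addrK r) => /lx [//|].
by rewrite -mulN1r => /nr.
Qed.

(** Since 1, t, ..., t^(d-1) is a basis, comparing coefficients of t would write 1 as a combination
    of the [a l], all of which vanish at y. *)
Lemma cover_tautological_notin (r : nat) (a : 'I_r -> rsec V)
    (b : 'I_r -> rsec (mpre f V)) :
  (forall l, ~ unit_at y (a l)) -> t <> \sum_l mco f V (a l) * b l.
Proof.
move=> na tE; have [g gK hK] := psi_iso V.
(* The index 1 of the summand M^-1, available because 1 < d. *)
pose i1 := Ordinal d_gt1; pose w l := g (b l).
have E : dsum_in (F := fun i : 'I_d => inv_pow i M) (i := i1)
    (form_pow (phi : msec (dual M) V) 1) = \sum_l a l *: w l.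
  apply: (bij_inj (psi_iso V)); rewrite (psi_pow _ i1) expr1 tE linear_sum.
  by apply: eq_bigr => l _; rewrite linearZ /= hK.
have /(congr1 (fun p : mform 1 M V => p V (@subset_refl _ V) (fun=> e))) :=
  congr1 (fun z => z i1) E.
rewrite dsum_inE dsum_sumE (form_pow_frame 1 e_phi).
have -> : forall F : 'I_r -> mform 1 M V,
    (\sum_l F l : mform 1 M V) V (@subset_refl _ V) (fun=> e) =
    \sum_l F l V (@subset_refl _ V) (fun=> e).
  by move=> F; elim/big_rec2: _ => [//|l v q _ <-].
move=> E1; apply: (@nonunit_at_sum _ Y y (@slocal _ Y) V 'I_r predT
  (fun l => a l * (w l i1 : mform 1 M V) V (@subset_refl _ V) (fun=> e))) => //.
  by move=> l _ /unit_atM [] /na.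
rewrite [X in unit_at y X](_ : _ = 1); first exact: unit_at1.
by rewrite E1; apply: eq_bigr => l _ /=; rewrite rres_id.
Qed.

End CyclicCover.

(** * The matrix of the tautological section on a relatively Ulrich bundle *)

Section UlrichCover.
Variables (k : comPzRingType) (X Y : scheme k) (f : morphism X Y) (d : nat).
Variables (M : omod Y) (s : msec (tensor_pow d M) (oT Y)).
Variable theta : omhom (dual M) (push f (ostruct X)).
Variable psi : omhom (dsum (fun i : 'I_d => inv_pow i M)) (push f (ostruct X)).
Hypothesis psi_iso : omiso psi.
Hypothesis psi_pow : forall (V : opens Y) (phi : msec (dual M) V) (i : 'I_d),
  psi V (dsum_in (F := fun i : 'I_d => inv_pow i M) (form_pow phi i)) =
  (theta V phi : rsec (mpre f V)) ^+ i.
Hypothesis theta_pow : forall (V : opens Y) (phi : msec (dual M) V),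
  (theta V phi : rsec (mpre f V)) ^+ d = mco f V (form_val s phi).
Hypothesis d_gt1 : (1 < d)%N.
Hypothesis fin_f : finite_morphism f.
Variable act : 'Z_d -> morphism X X.
Hypothesis qf : quotient_map act f.
Variables (E : omod X) (r : nat) (h : omhom (push f E) (ofree Y r)).
Hypothesis bE : vector_bundle E.
Hypothesis r_gt0 : (0 < r)%N.
Variable eps : 'I_r -> msec (push f E) (oT Y).
Hypothesis heps : forall V : opens Y,
  (forall l i, h V (mres (@sub_oT _ V) (eps l)) i = (l == i)%:R) /\
  (forall u : msec (push f E) V, u = \sum_l h V u l *: mres (@sub_oT _ V) (eps l)).

(** Entry (i, l) of multiplication by t in the basis [eps], kept as a function of [phi] so that it
    is a section of the double dual of M, ready for [line_bundle_reflexive]. *)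
Definition ulrich_entry (i l : 'I_r) (V : opens Y) (phi : msec (dual M) V) :
    rsec V :=
  h V (push_mul (theta V phi : rsec (mpre f V)) (mres (@sub_oT _ V) (eps l))) i.

Lemma ulrich_entryZ i l (V : opens Y) (a : rsec V) (phi : msec (dual M) V) :
  ulrich_entry i l (a *: phi) = a * ulrich_entry i l phi.
Proof.
rewrite /ulrich_entry linearZ /=.
have -> : forall b (u : msec (push f E) V),
    push_mul (a *: (b : msec (push f (ostruct X)) V) : rsec (mpre f V)) u =
    a *: push_mul b u.
  by move=> b u; exact/esym/(@scalerA _ (msec E (mpre f V))).
by rewrite linearZ.
Qed.

Lemma ulrich_entry_res i l (V W : opens Y) (t : W `<=` V)
    (phi : msec (dual M) V) :
  rres t (ulrich_entry i l phi) = ulrich_entry i l (mres t phi).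
Proof.
rewrite /ulrich_entry.
apply: (etrans (congr1 (fun z : msec (ofree Y r) W => z i) (mhom_res h t _))).
rewrite (push_mul_res t (mpre_sub t)).
rewrite (mres_comp _ _ (@sub_oT _ W)); congr (h W (push_mul _ _) i).
rewrite -(mhom_res theta t phi).
exact/esym/(@push_resE _ _ _ f (ostruct X) V W t (mpre_sub t) (theta V phi)).
Qed.

Lemma ulrich_entry_unit (y : Y) (V : opens Y) (e : msec M V) (phi : mform 1 M V) :
  V y -> dual_frame e phi ->
  exists i l, unit_at y (ulrich_entry i l (phi : msec (dual M) V)).
Proof.
move=> Vy fr; apply: contrapT => nex.
(* If every entry vanishes at y, then multiplication by t sends every section near y to one whose
   coordinates all vanish at y. *)
have hT (W : opens Y) (t : W `<=` V) (u : msec (push f E) W) i : W y ->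
    ~ unit_at y (h W (push_mul (theta W (mres t (phi : msec (dual M) V))
       : rsec (mpre f W)) u) i).
  move=> Wy; have [_ /(_ u) ->] := heps W.
  rewrite push_mul_sum linear_sum dsum_sumE.
  apply: nonunit_at_sum => // [|l _]; first exact: slocal.
  rewrite push_mulZ linearZ => /unit_atM [_].
  rewrite -[h W _ i]/(ulrich_entry i l (mres t (phi : msec (dual M) V))).
  rewrite -ulrich_entry_res unit_at_res // => ui.
  by apply: nex; exists i, l.
pose i0 := Ordinal r_gt0.
(* Apply [hT] to t^(d-1) e0: its product with t is s e0, whose coordinate [i0] is s itself. *)
have ns : ~ unit_at y (form_val s (phi : msec (dual M) V)).
  have idV : V `<=` V by [].
  pose e0 : msec (push f E) V := mres (@sub_oT _ V) (eps i0).
  pose t : rsec (mpre f V) := theta V (phi : msec (dual M) V).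
  have := hT V idV (push_mul (t ^+ d.-1) e0) i0 Vy.
  rewrite mres_id -/t.
  have -> : push_mul t (push_mul (t ^+ d.-1) e0) =
      form_val s (phi : msec (dual M) V) *: e0.
    apply: (etrans (@scalerA _ (msec E (mpre f V)) t (t ^+ d.-1) e0)).
    by rewrite -exprS prednK ?(ltnW d_gt1) // /t theta_pow.
  rewrite linearZ; have [/(_ i0 i0) he _] := heps V.
  rewrite (_ : _ i0 = form_val s (phi : msec (dual M) V)) //.
  by rewrite -[RHS]mulr1; congr (_ * _); rewrite he eqxx.
have [_ fsurj _ _ _] := qf.
have [x fx] := fsurj y.
(* Both points lie in the affine preimage of [U], so it suffices that the same functions are
   invertible at both. This is [cover_unit_at], applied over the intersection of [U] with the framed
   open [V]. *)
have one_pt x' : f x' = y -> x' = x.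
  move=> fx'; have [U [Uy _ aU _]] := fin_f y.
  have Ux : mpre f U x by rewrite /mpre /= fx.
  have Ux' : mpre f U x' by rewrite /mpre /= fx'.
  have [z [_ zu]] := affine_pts aU (nonunit_at_prime (@slocal _ X) Ux).
  rewrite -(zu x) ?(zu x') //; split=> //.
  apply/seteqP; suff H (b : rsec (mpre f U)) : unit_at x b <-> unit_at x' b.
    by split=> b /= nb; rewrite ?H // -H.
  pose l := mpre_sub (f := f) (@oI_subl _ V U).
  pose q := mpre_sub (f := f) (@oI_subr _ V U).
  have VUy (x0 : X) : f x0 = y -> mpre f (oI V U) x0.
    by move=> fx0; rewrite /mpre /= fx0.
  pose phiU : msec (dual M) (oI V U) := mform_res (@oI_subl _ V U) phi.
  have nsU : ~ unit_at y (form_val s phiU).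
    have -> : form_val s phiU =
        rres (@oI_subl _ V U) (form_val s (phi : msec (dual M) V)).
      by rewrite /form_val (mf_res _ _ _ (@sub_oT _ _)).
    by rewrite unit_at_res.
  have [a Ha] := cover_unit_at psi_iso psi_pow theta_pow d_gt1
    (dual_frame_res (@oI_subl _ V U) fr) (conj Vy Uy) (rres q b) nsU.
  by rewrite -(unit_at_res q _ (VUy _ fx)) -(unit_at_res q _ (VUy _ fx')) !Ha.
have [n [W [b [Wx bas]]]] := bE x.
(* The fibre being the single point x, the basis of E near x is defined over the preimage of a
   neighbourhood of y. *)
have [T [Ty TW]] : exists T : opens Y, T y /\ mpre f T `<=` W.
  by apply: (quotient_map_tube qf) => x' /one_pt ->.
pose V' := oI V T.
pose jl : V' `<=` V := @oI_subl _ V T.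
have jr : mpre f V' `<=` W.
  by apply: subset_trans TW; apply: mpre_sub; exact: oI_subr.
have V'y : V' y by [].
pose eps' l : msec E (mpre f V') := mres (@sub_oT _ V') (eps l).
have basis u := bas (mpre f V') jr u.
have [he hu] := heps V'.
(* In rank 0 the section [eps i0] would vanish over [V'], although its coordinate [i0] is 1, giving
   1 = 0 near y. *)
case: (posnP n) => [n0|n0].
  have u0 (u : msec E (mpre f V')) : u = 0.
    by have [a [-> _]] := basis u; rewrite big1 // => -[j jn]; exfalso; rewrite n0 in jn.
  apply: (@nonunit_at0 _ _ y (@slocal _ Y) V' V'y).
  have := he i0 i0; rewrite [mres _ _](u0 (eps' i0)) linear0 eqxx => E01.
  rewrite [X in unit_at y X](_ : _ = 1) //; exact: unit_at1.
pose j := Ordinal n0; pose bj : msec (push f E) V' := mres jr (b j).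
pose phi' : msec (dual M) V' := mres jl (phi : msec (dual M) V).
pose t : rsec (mpre f V') := theta V' phi'.
pose g l := projT1 (cid (basis (eps' l))).
have gE l : eps' l = \sum_i g l i *: mres jr (b i).
  by rewrite /g; case: cid => a /= [].
(* The coordinates of t b_j in the basis [b] are computed twice: directly in [e1]; in [e2] through
   [eps], with coefficients from Y that vanish at y by [hT]. Their j-th entries place t in m_y (f_*
   O_X)_y. *)
have [a0 [_ a0u]] := basis (push_mul t bj).
apply: (@cover_tautological_notin _ _ _ f d M theta psi psi_iso psi_pow d_gt1
  V' _ _ (dual_frame_res jl fr) y V'y r (fun l => h V' (push_mul t bj) l) (fun l => g l j)).
  by move=> l; exact: hT.
have e1 : a0 = [ffun i => if i == j then t else 0].
  apply: a0u; rewrite (bigD1 j) //= ffunE eqxx big1 ?addr0 // => i ij.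
  by rewrite ffunE (negbTE ij) scale0r.
have e2 : a0 = [ffun i => \sum_l mco f V' (h V' (push_mul t bj) l) * g l i].
  apply: a0u; rewrite [LHS]hu.
  under [RHS]eq_bigr => i _ do rewrite ffunE scaler_suml.
  rewrite exchange_big; apply: eq_bigr => l _ /=.
  (* A scalar from Y acts on the pushforward through [mco] by definition. *)
  transitivity (mco f V' (h V' (push_mul t bj) l) *: eps' l) => //.
  by rewrite gE scaler_sumr; apply: eq_bigr => i _; rewrite scalerA.
by have := congr1 (fun z : {ffun _} => z j) e1; rewrite e2 !ffunE eqxx.
Qed.

End UlrichCover.

(** * Global generation of M *)

Theorem proposition3p10 (k : closedFieldType) (char0 : [pchar k] =i pred0)
    (X Y : scheme k) (hX : projective_variety X) (hY : projective_variety Y)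
    (pi : morphism X Y) (d : nat) (M : omod Y)
    (s : msec (tensor_pow d M) (oT Y))
    (hpi : standard_cyclic_cover pi s)
    (E : omod X) (hE : vector_bundle E) (hU : relatively_ulrich pi E)
    (hB : reduced_zeros s) :
  globally_generated M.
Proof.
have [d_gt1 fin_pi [act [_ qpi _]] lM [_ [theta [psi [psi_iso psi_pow th_pow]]]]]
  := hpi.
have [r [r_gt0 [h hiso]]] := hU.
have [eps heps] := free_push_basis hiso.
move=> y V u Vy.
have [U [e [phi [Uy fr]]]] := line_bundle_dual_frame y lM.
have [i [l [W [t [c [Wy ec]]]]]] := ulrich_entry_unit psi_iso psi_pow th_pow
  d_gt1 fin_pi qpi hE r_gt0 heps Uy fr.
(* The entry invertible at y becomes a global section [g] of M, equal on [U] to that entry times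
   [e]. *)
have [g /(_ _ _ _ fr) gE] := line_bundle_reflexive lM
  (ulrich_entryZ theta h eps i l) (ulrich_entry_res theta h eps i l).
pose T := oI V W; pose TW : T `<=` W := @oI_subr _ V W.
pose TU := subset_trans TW t.
have [/(_ (mres (@oI_subl _ V W) u)) uE _] := fr T TU.
set a := (phi T TU _) in uE.
(* One generator suffices: u = a e on [T], and e = c g there because [c] inverts the entry. *)
exists T, (@oI_subl _ V W), 1%N, (fun=> g), (fun=> a * rres TW c); split=> //.
rewrite big_ord1 {1}uE -(mres_comp (@sub_oT _ U) TU) gE mresZ scalerA.
by rewrite -(rres_comp t TW TU) -mulrA -rmorphM [c * _]mulrC ec rmorph1 mulr1.
Qed.
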